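(* Let $n$ be an integer with $8\le n<\infty$, and let $A=\mathrm{IDD}(K^1_n,0,-2)$ be the complex algebra with basis $e_1,\ldots,e_n$ and bilinear multiplication $e_i\diamond e_j=\frac{1}{(j+1)(j+2)}e_{i+j+2}$ if $i+j\le n-2$, and $e_i\diamond e_j=0$ otherwise. Then the space of derivations of $A$ is $$\mathfrak{Der}(A)=\langle\varphi,\ \phi_i,\ \psi_j,\ \pi_k : 0\le i\le 4,\ 0\le j\le 2,\ 0\le k\le 2\rangle,$$ where these linear maps are given on the basis (all values not listed being zero) by - $\varphi(e_i)=(i+2)e_i$ for $1\le i\le n$; - $\phi_4(e_1)=(n-3)(n^2-4)e_{n-4}$, $\phi_4(e_2)=n(n-1)(n-2)e_{n-3}$, $\phi_4(e_4)=(n+2)(n^2-5n+12)e_{n-1}$, $\phi_4(e_5)=(n+1)(n^2-4n+12)e_n$; - $\phi_3(e_1)=(n-1)(n-2)e_{n-3}$, $\phi_3(e_4)=(n^2-3n+8)e_n$; - $\phi_2(e_1)=e_{n-2}$; $\ \phi_1(e_1)=e_{n-1}$; $\ \phi_0(e_1)=e_n$; - $\psi_2(e_2)=e_{n-2}$; $\ \psi_1(e_2)=e_{n-1}$; $\ \psi_0(e_2)=e_n$; - $\pi_2(e_3)=e_{n-2}$; $\ \pi_1(e_3)=e_{n-1}$; $\ \pi_0(e_3)=e_n$.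
   Context: A derivation of an algebra $(A,\diamond)$ is a linear map $D:A\to A$ with $D(a\diamond b)=D(a)\diamond b+a\diamond D(b)$ for all $a,b\in A$. $\langle S\rangle$ denotes the linear span of $S$ over $\mathbb C$. *)

(* Defs.v *)
From HB Require Import structures.
From mathcomp Require Import all_boot all_order all_algebra.
From mathcomp Require Import reals.
From mathcomp Require Import complex.

Set Implicit Arguments.
Unset Strict Implicit.
Unset Printing Implicit Defensive.

Import GRing.Theory.
Local Open Scope ring_scope.

Definition is_derivation (K : fieldType) (A : vectType K) (mul : A -> A -> A)
    (D : 'End(A)) : Prop :=
  forall a b : A, D (mul a b) = mul (D a) b + mul a (D b).

Section IDD.
Variables (K : fieldType) (n : nat).
Local Notation V := 'rV[K]_n.

(* The paper's 1-based basis vector [e_k], [1 <= k <= n]; the coordinate of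
   [e_k] equal to 1 has 0-based index [k - 1], and [e k = 0] for [k] out of
   range. *)
Definition e (k : nat) : V := \row_(j < n) (j.+1 == k)%:R.

(* [linext f] is the linear map with [e_k |-> f k] for [1 <= k <= n]. *)
Definition linext_fun (f : nat -> V) (v : V) : V :=
  \sum_(i < n) v 0 i *: f i.+1.

Fact linext_fun_is_linear f : linear (linext_fun f).
Proof.
move=> a u v; rewrite /linext_fun scaler_sumr -big_split /=.
by apply: eq_bigr => i _; rewrite !mxE scalerDl scalerA.
Qed.

HB.instance Definition _ (f : nat -> V) :=
  GRing.isLinear.Build K V V *:%R (linext_fun f) (linext_fun_is_linear f).

Definition linext (f : nat -> V) : 'End(V) := linfun (linext_fun f).

Definition idd_mul_basis (i j : nat) : V :=
  if (i + j <= n - 2)%N then ((j.+1 * j.+2)%N%:R)^-1 *: e (i + j + 2) else 0.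

Definition idd_mul (a b : V) : V :=
  \sum_(i < n) \sum_(j < n) (a 0 i * b 0 j) *: idd_mul_basis i.+1 j.+1.

Lemma sum_e (f : nat -> V) (k : 'I_n) :
  \sum_(i < n) e k.+1 0 i *: f i.+1 = f k.+1.
Proof.
rewrite (bigD1 k) //= big1 ?addr0 => [|i ik]; first by rewrite mxE eqxx scale1r.
by rewrite mxE eqSS (inj_eq val_inj) (negPf ik) scale0r.
Qed.

Lemma linext_e (f : nat -> V) (k : nat) :
  (1 <= k <= n)%N -> linext f (e k) = f k.
Proof.
case: k => // k /= kn; rewrite lfunE /=.
exact: (sum_e f (Ordinal kn)).
Qed.

Lemma idd_mul_e (i j : nat) : (1 <= i <= n)%N -> (1 <= j <= n)%N ->
  idd_mul (e i) (e j) = idd_mul_basis i j.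
Proof.
case: i j => // i [] // j /= lin ljn; rewrite /idd_mul.
under eq_bigr => k _.
  under eq_bigr => l _ do rewrite -scalerA.
  rewrite -scaler_sumr (sum_e (idd_mul_basis k.+1) (Ordinal ljn)).
  over.
exact: (sum_e (idd_mul_basis^~ j.+1) (Ordinal lin)).
Qed.

Local Notation N := (n%:R : K).

Definition varphi : 'End(V) := linext (fun k => (k + 2)%N%:R *: e k).

Definition phi4 : 'End(V) := linext (fun k =>
  match k with
  | 1 => ((N - 3) * (N ^+ 2 - 4)) *: e (n - 4)
  | 2 => (N * (N - 1) * (N - 2)) *: e (n - 3)
  | 4 => ((N + 2) * (N ^+ 2 - 5 * N + 12)) *: e (n - 1)
  | 5 => ((N + 1) * (N ^+ 2 - 4 * N + 12)) *: e n
  | _ => 0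
  end).

Definition phi3 : 'End(V) := linext (fun k =>
  match k with
  | 1 => ((N - 1) * (N - 2)) *: e (n - 3)
  | 4 => (N ^+ 2 - 3 * N + 8) *: e n
  | _ => 0
  end).

(* [e_s |-> e_(n - t)], all other basis vectors to 0: [s = 1, 2, 3] gives the
   maps [phi_t], [psi_t], [pi_t] respectively, for [0 <= t <= 2]. *)
Definition unit_map (s t : nat) : 'End(V) :=
  linext (fun k => if k == s then e (n - t) else 0).

Definition phi (t : nat) : 'End(V) :=
  match t with 4 => phi4 | 3 => phi3 | _ => unit_map 1 t end.
Definition psi (t : nat) : 'End(V) := unit_map 2 t.
Definition pi_ (t : nat) : 'End(V) := unit_map 3 t.

Definition der_generators : seq 'End(V) :=
  varphi :: [seq phi i | i <- iota 0 5] ++ [seq psi j | j <- iota 0 3]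
         ++ [seq pi_ k | k <- iota 0 3].

End IDD.

(* Main.v *)
From HB Require Import structures.
Require Import Defs.
From mathcomp Require Import all_boot all_order all_algebra.
From mathcomp Require Import reals.
From mathcomp Require Import complex.
From mathcomp Require Import ring zify.
Local Open Scope ring_scope.
Import GRing.Theory Num.Theory.

(** Write [d k t] for the coefficient of [e t] in [D (e k)] and [c j] for
    [1 / ((j + 1) (j + 2))].  The product is bilinear and sends [e i, e j] to
    [c j] times [e (i + j + 2)], so [D] is a derivation exactly when

      [c j * d (i + j + 2) t
         = c j * d i (t - j - 2) + c (t - i - 2) * d j (t - i - 2)]

    for all [i], [j], [t] between 1 and [n] ([derivationP]).  Giving [e k] the
    weight [k + 2] grades the algebra, and these equations only relate entries
    of a common degree [r = t - k], which may be treated one at a time.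

    For [r >= 0] put [x k = d k (k + r)] and [u k = c (k + r) * x k].  The
    equations read [x (i + j + 2) = x i + (j + 1) (j + 2) u j].  With [j = 1]
    they show that [x 1], [x 2], [x 3] determine everything
    ([entry_diag_eq0]).  Exchanging [i] and [j] gives, for [r > 0], that
    [(r + 2 i + 3) u i] does not depend on [i] ([scaled_sym]); hence [u 1]
    determines [u 2] when [r + 5 <= n], and also [u 3] when [r + 6 <= n].  In
    the latter case, comparing the two expressions [(i, j) = (1, 3), (2, 2)] of
    [x 6] yields [2 (r - 1) (r + 1) u 1 = 0], so that nothing survives in these
    degrees, except possibly for [r = 1], where the equations that reach up to
    [e 8] finish the job; this is where [8 <= n] enters.  In negative degree
    all entries vanish ([entry_lower]) and in degree 0 only the multiples of
    [varphi] remain ([entry_diag0]).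

    Consequently only degree 0 and the degrees [r >= n - 5] matter, and a
    derivation is zero as soon as twelve of its entries are: [d 1 1], the last
    five entries of row 1 and the last three of rows 2 and 3
    ([derivation_eq0]).  The twelve generators are derivations
    ([der_generators_derivation]), and subtracting a suitable combination of
    them from a given derivation makes these twelve entries vanish, because
    each generator has exactly one nonzero entry among them. *)

Set Implicit Arguments.
Unset Strict Implicit.
Unset Printing Implicit Defensive.

(** * Coordinates indexed from 1 *)

Section Coordinates.
Variables (K : fieldType) (n : nat).
Local Notation V := 'rV[K]_n.
Local Notation e := (@e K n).

(** The coefficient of [e t] in [v]; being 0 for [t = 0] and [t > n], it lets
    degree arguments be carried out on natural numbers, with truncated
    subtraction, without range conditions. *)
Definition ecoef (t : nat) (v : V) : K := \sum_(j < n | j.+1 == t) v 0 j.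

Fact ecoef_is_linear t : linear_for *%R (ecoef t).
Proof.
move=> a u v; rewrite /ecoef mulr_sumr -big_split /=.
by apply: eq_bigr => i _; rewrite !mxE.
Qed.

HB.instance Definition _ t :=
  GRing.isLinear.Build K V K *%R (ecoef t) (ecoef_is_linear t).

Lemma ecoefZ t a v : ecoef t (a *: v) = a * ecoef t v.
Proof. exact: linearZ. Qed.

Lemma ecoef_ord (j : 'I_n) v : ecoef j.+1 v = v 0 j.
Proof. by rewrite /ecoef (big_pred1 j). Qed.

Lemma ecoef_out t v : ~~ (0 < t <= n)%N -> ecoef t v = 0.
Proof.
move=> out; rewrite /ecoef big_pred0 // => j; apply/negP => /eqP jt.
by move: out; rewrite -jt ltn_ord.
Qed.

Lemma ecoef_e t k : ecoef t (e k) = ((k == t) && (0 < t <= n)%N)%:R.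
Proof.
case: (boolP (0 < t <= n)%N) => [|/ecoef_out->]; last by rewrite andbF.
by case: t => // t tn; rewrite (ecoef_ord (Ordinal tn)) mxE andbT eq_sym.
Qed.

Lemma ecoef_inj v w :
  (forall t, (0 < t <= n)%N -> ecoef t v = ecoef t w) -> v = w.
Proof.
by move=> eq_vw; apply/rowP => j; rewrite -!ecoef_ord eq_vw //= ltn_ord.
Qed.

Lemma e_out k : ~~ (0 < k <= n)%N -> e k = 0.
Proof.
move=> out; apply: ecoef_inj => t tn; rewrite ecoef_e linear0.
by have /negPf->: k != t by apply: contraNneq out => ->.
Qed.

Lemma row_sum_e (v : V) : v = \sum_(i < n) v 0 i *: e i.+1.
Proof.
apply: ecoef_inj => t tn; rewrite linear_sum /ecoef big_mkcond /=.
apply: eq_bigr => i _; rewrite linearZ /= -/(ecoef t (e i.+1)) ecoef_e tn andbT.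
by case: ifP; rewrite ?mulr1 ?mulr0.
Qed.

Lemma ecoef_row_sum t (v : V) (f : nat -> K) :
  \sum_(j < n) v 0 j * (f j.+1 * (j.+1 == t)%:R) = f t * ecoef t v.
Proof.
rewrite /ecoef mulr_sumr [RHS]big_mkcond; apply: eq_bigr => j _ /=.
by case: eqP => [->|_]; rewrite ?mulr0 // mulr1 mulrC.
Qed.

End Coordinates.

(** * Derivations as solutions of a linear system *)

Section Product.
Variables (K : fieldType) (n : nat).
Local Notation V := 'rV[K]_n.
Local Notation e := (@e K n).
Local Notation mul := (@idd_mul K n).

Definition struct_const (j : nat) : K := ((j.+1 * j.+2)%N%:R)^-1.

(** The case distinction in the product disappears because [e k = 0] for
    [k > n]. *)
Lemma idd_mul_basisE i j : (0 < i)%N ->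
  idd_mul_basis K n i j = struct_const j *: e (i + j + 2).
Proof.
move=> i0; rewrite /idd_mul_basis; case: ifP => // ij.
by rewrite e_out ?scaler0 //; lia.
Qed.

Fact idd_mul_is_linear a : linear (mul a).
Proof.
move=> x u v; rewrite /idd_mul scaler_sumr -big_split; apply: eq_bigr => i _ /=.
rewrite scaler_sumr -big_split; apply: eq_bigr => j _ /=.
by rewrite !mxE mulrDr scalerDl scalerA mulrCA.
Qed.

HB.instance Definition _ a :=
  GRing.isLinear.Build K V V *:%R (mul a) (idd_mul_is_linear a).

(** The product as a linear map of its left factor. *)
Definition idd_mulr b a := mul a b.

Fact idd_mulr_is_linear b : linear (idd_mulr b).
Proof.
move=> x u v; rewrite /idd_mulr /idd_mul scaler_sumr -big_split.
apply: eq_bigr => i _ /=; rewrite scaler_sumr -big_split.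
by apply: eq_bigr => j _ /=; rewrite !mxE mulrDl scalerDl scalerA mulrA.
Qed.

HB.instance Definition _ b :=
  GRing.isLinear.Build K V V *:%R (idd_mulr b) (idd_mulr_is_linear b).

Lemma lin_expand (f : {linear V -> V}) v :
  f v = \sum_(i < n) v 0 i *: f (e i.+1).
Proof.
rewrite [in LHS](row_sum_e v) linear_sum; apply: eq_bigr => i _.
exact: linearZ.
Qed.

Lemma mul_expandr a b : mul a b = \sum_(j < n) b 0 j *: mul a (e j.+1).
Proof. exact: (lin_expand (mul a)). Qed.

Lemma mul_expandl a b : mul a b = \sum_(i < n) a 0 i *: mul (e i.+1) b.
Proof. exact: (lin_expand (idd_mulr b)). Qed.

(** For [t <= i + 2] the truncated subtraction makes the right-hand side the
    coefficient of [e 0], that is 0. *)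
Lemma ecoef_mul_e i t v : (0 < i <= n)%N -> (0 < t <= n)%N ->
  ecoef t (mul (e i) v) = struct_const (t - i - 2) * ecoef (t - i - 2) v.
Proof.
move=> iin tn; rewrite mul_expandr linear_sum -ecoef_row_sum.
apply: eq_bigr => j _; rewrite /= ecoefZ idd_mul_e //; last exact: ltn_ord.
rewrite idd_mul_basisE ?ecoefZ ?ecoef_e ?tn ?andbT; last by case/andP: iin.
by congr (_ * (_ * _%:R)); lia.
Qed.

Lemma ecoef_e_mul j t v : (0 < j <= n)%N -> (0 < t <= n)%N ->
  ecoef t (mul v (e j)) = struct_const j * ecoef (t - j - 2) v.
Proof.
move=> jin tn; rewrite mul_expandl.
rewrite linear_sum -(ecoef_row_sum (t - j - 2)%N v (fun=> struct_const j)).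
apply: eq_bigr => i _; rewrite /= ecoefZ idd_mul_e //; last exact: ltn_ord.
rewrite idd_mul_basisE ?ecoefZ ?ecoef_e ?tn ?andbT //.
by congr (_ * (_ * _%:R)); lia.
Qed.

Definition entry (D : 'End(V)) (k t : nat) : K := ecoef t (D (e k)).

Lemma entry_row0 D t : entry D 0 t = 0.
Proof. by rewrite /entry e_out // !linear0. Qed.

Lemma entry_col_out D k t : ~~ (0 < t <= n)%N -> entry D k t = 0.
Proof. exact: ecoef_out. Qed.

Lemma entry_row_out D k t : (n < k)%N -> entry D k t = 0.
Proof. by move=> nk; rewrite /entry e_out ?linear0 //; lia. Qed.

Lemma entry_eq0 D :
  (forall k t, (0 < k <= n)%N -> (0 < t <= n)%N -> entry D k t = 0) -> D = 0.
Proof.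
move=> D0; apply/lfunP => v; rewrite lfunE /= (lin_expand D) big1 // => i _.
suff De0: D (e i.+1) = 0 by rewrite /= De0 scaler0.
by apply: ecoef_inj => t tn; rewrite linear0; apply: D0 => //=.
Qed.

Lemma entry_comb a D1 D2 k t :
  entry (a *: D1 + D2) k t = a * entry D1 k t + entry D2 k t.
Proof. by rewrite /entry !lfunE /= !lfunE /= linearD /= ecoefZ. Qed.

(** The [e t]-coefficient of the Leibniz rule for [e i] and [e j]. *)
Definition entry_der (D : 'End(V)) i j t :=
  struct_const j * entry D (i + j + 2) t
  = struct_const j * entry D i (t - j - 2)
    + struct_const (t - i - 2) * entry D j (t - i - 2).

(** By bilinearity the Leibniz rule need only be checked on basis vectors,
    coefficient by coefficient. *)
Lemma derivationP D :
  is_derivation mul D <->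
  (forall i j t, (0 < i <= n)%N -> (0 < j <= n)%N -> (0 < t <= n)%N ->
     entry_der D i j t).
Proof.
have main i j : (0 < i <= n)%N -> (0 < j <= n)%N ->
    D (mul (e i) (e j)) = mul (D (e i)) (e j) + mul (e i) (D (e j)) <->
    (forall t, (0 < t <= n)%N -> entry_der D i j t).
  move=> iin jin; rewrite idd_mul_e // idd_mul_basisE; last by case/andP: iin.
  rewrite linearZ /=; split=> [eqD t tn | eqD].
    rewrite /entry_der -[LHS]ecoefZ eqD linearD /=.
    by rewrite ecoef_mul_e // ecoef_e_mul.
  apply: ecoef_inj => t tn; rewrite ecoefZ [LHS]eqD // linearD /=.
  by rewrite ecoef_mul_e // ecoef_e_mul.
split=> [derD i j t iin jin tn | derD a b]; first exact: (main i j iin jin).1.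
have derr i : (0 < i <= n)%N ->
    D (mul (e i) b) = mul (D (e i)) b + mul (e i) (D b).
  move=> iin; rewrite (mul_expandr _ b) (mul_expandr (D _) b) (lin_expand D b).
  rewrite (linear_sum D) (linear_sum (mul (e i))) -big_split.
  apply: eq_bigr => j _; rewrite /= !linearZ /= -scalerDr; congr (_ *: _).
  by apply: (main i j.+1 iin (ltn_ord j)).2 => t tn; apply: derD => //=.
rewrite (mul_expandl a b) (mul_expandl a (D b)) (lin_expand D a) (linear_sum D).
rewrite -[mul _ b]/(idd_mulr b _) (linear_sum (idd_mulr b)) -big_split.
apply: eq_bigr => i _; rewrite /= !linearZ /= derr ?(ltn_ord i) //.
by rewrite -scalerDr.
Qed.

Lemma derivation_comb a D1 D2 : is_derivation mul D1 -> is_derivation mul D2 ->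
  is_derivation mul (a *: D1 + D2).
Proof.
move=> der1 der2 u v.
have combE w : (a *: D1 + D2) w = a *: D1 w + D2 w by rewrite !lfunE /= !lfunE.
have mulDl x w z : mul (a *: x + w) z = a *: mul x z + mul w z.
  exact: (idd_mulr_is_linear z a x w).
have mulDr x w z : mul z (a *: x + w) = a *: mul z x + mul z w.
  exact: (idd_mul_is_linear z a x w).
by rewrite !combE der1 der2 mulDl mulDr scalerDr addrACA.
Qed.

Lemma derivation_span (X : seq 'End(V)) :
  {in X, forall D, is_derivation mul D} ->
  {in <<X>>%VS, forall D, is_derivation mul D}.
Proof.
move=> derX D /(coord_span (X := in_tuple X)) ->.
apply: big_rec => [u v | i D' _ derD'].
  rewrite !lfunE /= -[mul 0 v]/(idd_mulr v 0).
  by rewrite (linear0 (idd_mulr v)) (linear0 (mul u)) addr0.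
by apply: derivation_comb => //; apply/derX/mem_nth; rewrite ltn_ord.
Qed.

End Product.

(** * A derivation is determined by twelve of its entries *)

Section Rigidity.
Variables (K : numFieldType) (n : nat).
Local Notation V := 'rV[K]_n.
Local Notation mul := (@idd_mul K n).

Lemma struct_const_neq0 j : struct_const K j != 0.
Proof. by rewrite /struct_const invr_eq0 pnatr_eq0. Qed.

Lemma struct_const_inj : injective (struct_const K).
Proof. move=> j k /invr_inj/eqP; rewrite eqr_nat => /eqP; nia. Qed.

Section Derivation.
Variable D : 'End(V).
Hypothesis n8 : (8 <= n)%N.
Hypothesis derD : is_derivation mul D.
Local Notation d := (entry D).

(** In negative degree the terms that involve [D (e 1)] contribute nothing.
    The pairs [(i, 1)] and [(1, i)] then both express [d (i + 3) (u + 3)] as a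
    multiple of [d i u], with the distinct factors [1] and [c u / c i]. *)
Lemma entry_lower k t : (t < k)%N -> d k t = 0.
Proof.
have der i j t' := (derivationP D).1 derD i j t'.
have shift i u : (0 < i <= n)%N -> (u < i)%N -> (u + 3 <= n)%N ->
    d (i + 3) (u + 3) = d i u.
  move=> iin ui un; have := der i 1%N (u + 3)%N iin.
  rewrite /entry_der (_ : u + 3 - 1 - 2 = u)%N; last lia.
  rewrite (_ : u + 3 - i - 2 = 0)%N ?(entry_col_out D _ (t := 0)); try lia.
  rewrite mulr0 addr0.
  rewrite (_ : i + 1 + 2 = i + 3)%N; last lia.
  by move=> eqD; apply: (mulfI (struct_const_neq0 1)); apply: eqD; lia.
have low i u : (u < i)%N -> (u + 3 <= n)%N -> d i u = 0.
  move=> ui un; case: (leqP i n) => [lin|]; last exact: entry_row_out.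
  case: u ui un => [|u] ui un; first by rewrite entry_col_out.
  have := der 1%N i (u.+1 + 3)%N; rewrite /entry_der.
  rewrite (_ : u.+1 + 3 - 1 - 2 = u.+1)%N; last lia.
  rewrite (_ : u.+1 + 3 - i - 2 = 0)%N
    ?(entry_col_out D _ (t := 0)) ?mulr0 ?add0r; try lia.
  rewrite (_ : 1 + i + 2 = i + 3)%N ?shift //; try lia.
  move=> eqD; apply/eqP.
  have/eqP : (struct_const K i - struct_const K u.+1) * d i u.+1 = 0.
    by rewrite mulrBl eqD ?subrr //; lia.
  by rewrite mulf_eq0 subr_eq0 => /orP[/eqP/struct_const_inj|//]; lia.
move=> tk; case: (leqP k n) => kn; last exact: entry_row_out.
case: (posnP t) => [->|t0]; first by rewrite entry_col_out.
case: (leqP (t + 3) n) => [|tn]; first exact: low.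
have -> : k = (k - 3 + 3)%N by lia.
have -> : t = (t - 3 + 3)%N by lia.
by rewrite shift ?low //; lia.
Qed.

Lemma entry_graded i j r : (0 < i)%N -> (0 < j)%N -> (i + j + 2 + r <= n)%N ->
  d (i + j + 2) (i + j + 2 + r)
  = d i (i + r) + (j.+1 * j.+2)%N%:R * (struct_const K (j + r) * d j (j + r)).
Proof.
move=> i0 j0 tn; have := (derivationP D).1 derD i j (i + j + 2 + r)%N.
rewrite /entry_der (_ : i + j + 2 + r - j - 2 = i + r)%N; last lia.
rewrite (_ : i + j + 2 + r - i - 2 = j + r)%N; last lia.
move=> eqD; apply: (mulfI (struct_const_neq0 j)).
rewrite mulrDr [X in _ + X]mulrA mulVf ?pnatr_eq0 // mul1r.
by apply: eqD; lia.
Qed.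

(** Taking [j = 1] moves along the diagonal by steps of three, so its first
    three entries determine it. *)
Lemma entry_diag_eq0 r :
  d 1 (1 + r) = 0 -> d 2 (2 + r) = 0 -> d 3 (3 + r) = 0 ->
  forall k, d k (k + r) = 0.
Proof.
move=> d1 d2 d3 k; elim/ltn_ind: k => -[|[|[|[|k]]]] IHk //.
  exact: entry_row0.
case: (leqP (k.+4 + r) n) => kn; last by rewrite entry_col_out //; lia.
have := @entry_graded k.+1 1 r isT isT.
rewrite (_ : k.+1 + 1 + 2 = k.+4)%N; last lia.
by move=> ->; rewrite ?IHk ?d1 ?mulr0 ?addr0 //; lia.
Qed.

(* Rescaling the entries by the structure constants clears the denominators
    from the relations below. *)
Local Notation u r j := (struct_const K (j + r) * d j (j + r)).

Lemma entry_scaled r j : d j (j + r) = ((j + r).+1 * (j + r).+2)%N%:R * u r j.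
Proof. by rewrite mulrA divff ?mul1r ?pnatr_eq0. Qed.

(** In degree 0 the relations are [x (i + j + 2) = x i + x j]; with [x 1 = 0],
    computing [x 6] and [x 7] in two ways gives [3 x 2 = 0]. *)
Lemma entry_diag0 : d 1 1 = 0 -> forall k, d k k = 0.
Proof.
move=> d1 k; have add i j : (0 < i)%N -> (0 < j)%N -> (i + j + 2 <= n)%N ->
    d (i + j + 2) (i + j + 2) = d i i + d j j.
  move=> i0 j0 tn; have := @entry_graded i j 0 i0 j0; rewrite !addn0 => -> //.
  by rewrite mulrA divff ?mul1r ?pnatr_eq0.
have d4 : d 4 4 = 0 by rewrite (add 1%N 1%N) ?d1 ?addr0 //; lia.
have d6 : d 3 3 = d 2 2 + d 2 2.
  by rewrite -(add 2%N 2%N) ?(add 1%N 3%N) ?d1 ?add0r //; lia.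
have d7 : 0 = d 2 2 + d 3 3.
  by rewrite -(add 2%N 3%N) ?(add 1%N 4%N) ?d1 ?d4 ?addr0 //; lia.
have d2 : d 2 2 = 0.
  apply/eqP; have/eqP : 3 * d 2 2 = 0 by rewrite d7 d6; ring.
  by rewrite mulf_eq0 pnatr_eq0.
have := @entry_diag_eq0 0%N; rewrite !addn0 => diag.
rewrite -[X in d _ X]addn0; apply: diag => //.
by rewrite d6 d2 addr0.
Qed.

Lemma scaled_shift i j r : (0 < i)%N -> (0 < j)%N -> (i + j + 2 + r <= n)%N ->
  d (i + j + 2) (i + j + 2 + r)
  = ((i + r).+1 * (i + r).+2)%N%:R * u r i + (j.+1 * j.+2)%N%:R * u r j.
Proof. by move=> i0 j0 tn; rewrite -entry_scaled entry_graded. Qed.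

(** The difference of the relations for [(i, j)] and [(j, i)]: their left-hand
    sides agree, and
    [(i + r + 1) (i + r + 2) - (i + 1) (i + 2) = r (r + 2 i + 3)]. *)
Lemma scaled_sym i j r : (0 < i)%N -> (0 < j)%N -> (i + j + 2 + r <= n)%N ->
  (0 < r)%N -> (r + 2 * i + 3)%:R * u r i = (r + 2 * j + 3)%:R * u r j.
Proof.
move=> i0 j0 tn r0.
have := @scaled_shift j i r j0 i0;
rewrite (addnC j i) scaled_shift // => /(_ tn).
set x := u r i; set y := u r j => /eqP; rewrite -subr_eq0 => /eqP eqD.
apply: (mulfI (_ : r%:R != 0)); first by rewrite pnatr_eq0 -lt0n.
by apply/eqP; rewrite -subr_eq0 -[X in _ == X]eqD; apply/eqP; ring.
Qed.

(** The relation between [u 1], [u 2], [u 3] used in higher degree degenerates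
    for [r = 1]; instead [u 4] is compared with [u 1] through
    [12 u 4 = 6 u 1] and [x 4 = 42 u 4 = 18 u 1].  The former comes from the
    pair [(4, 1)], whose product reaches [e 8] after the shift by [r]. *)
Lemma entry_diag1 k : d k (k + 1) = 0.
Proof.
have sym j : (0 < j < 5)%N -> (4 + 2 * j)%:R * u 1 j = 6 * u 1 1.
  by move=> j5; rewrite -(@scaled_sym j 1 1); try lia; congr (_%:R * _); lia.
have u1_0 : u 1 1 = 0.
  have x4 : 42 * u 1 4 = 12 * u 1 1 + 6 * u 1 1.
    by rewrite -(@entry_scaled 1 4) -(@scaled_shift 1 1 1) //; lia.
  have s4 : 12 * u 1 4 = 6 * u 1 1 := sym 4%N isT.
  apply: (mulfI (_ : 6 != 0 :> K)); rewrite ?pnatr_eq0 // mulr0.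
  transitivity (2 * (42 * u 1 4 - (12 * u 1 1 + 6 * u 1 1))
                - 7 * (12 * u 1 4 - 6 * u 1 1)); first by ring.
  by rewrite x4 s4 !subrr !mulr0 subr0.
have u_0 j : (0 < j < 5)%N -> d j (j + 1) = 0.
  move=> j5; rewrite entry_scaled (_ : u 1 j = 0) ?mulr0 //.
  apply: (mulfI (_ : (4 + 2 * j)%:R != 0 :> K)); first by rewrite pnatr_eq0.
  by rewrite sym // u1_0 !mulr0.
by apply: entry_diag_eq0; apply: u_0.
Qed.

(** [u 2] and [u 3] are multiples of [u 1], and the two expressions of [x 6]
    then leave [2 (r - 1) (r + 1) u 1 = 0]. *)
Lemma entry_diag_mid r k : (1 < r)%N -> (r + 6 <= n)%N -> d k (k + r) = 0.
Proof.
move=> r1 rn; have r0 : (0 < r)%N by lia.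
have sym j : (0 < j < 4)%N -> (r + 2 * j + 3)%:R * u r j = (r + 5)%:R * u r 1.
  move=> j4; rewrite (@scaled_sym j 1 r) //; try lia.
  by congr (_%:R * _); lia.
have u1_0 : u r 1 = 0.
  have x6 : ((r + 2) * (r + 3))%N%:R * u r 1 + 20 * u r 3
          = ((r + 3) * (r + 4))%N%:R * u r 2 + 12 * u r 2.
    transitivity (d 6 (6 + r)).
      rewrite (@scaled_shift 1 3); try lia.
      by congr (_%:R * _ + _%:R * _); lia.
    rewrite (@scaled_shift 2 2); try lia.
    by congr (_%:R * _ + _%:R * _); lia.
  have s2 := sym 2%N isT; have s3 := sym 3%N isT.
  apply: (mulfI (_ : 2 * (r - 1)%N%:R * (r + 1)%N%:R != 0 :> K)).
    by rewrite !mulf_neq0 ?pnatr_eq0 //; lia.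
  rewrite mulr0 natrB ?(ltnW r1) //.
  (* Elimination of [u 2] and [u 3]: the equation of [x 6] is multiplied by
     [(r + 7) (r + 9)], the two others by the coefficients that these unknowns
     then have. *)
  transitivity ((r + 7)%:R * (r + 9)%:R
    * ((((r + 2) * (r + 3))%N%:R * u r 1 + 20 * u r 3)
       - (((r + 3) * (r + 4))%N%:R * u r 2 + 12 * u r 2))
    + (r + 9)%:R * ((r + 3) * (r + 4) + 12)%:R
       * ((r + 2 * 2 + 3)%:R * u r 2 - (r + 5)%:R * u r 1)
    - 20 * (r + 7)%:R * ((r + 2 * 3 + 3)%:R * u r 3 - (r + 5)%:R * u r 1)).
    by ring.
  by rewrite x6 s2 s3 !subrr !mulr0 subr0 addr0.
have u_0 j : (0 < j < 4)%N -> d j (j + r) = 0.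
  move=> j4; rewrite entry_scaled (_ : u r j = 0) ?mulr0 //.
  apply: (mulfI (_ : (r + 2 * j + 3)%:R != 0 :> K)).
    by rewrite pnatr_eq0; lia.
  by rewrite sym // u1_0 !mulr0.
by apply: entry_diag_eq0; apply: u_0.
Qed.

(** This is for degree [n - 5], in which [x 1] and [x 3] are free but [x 2] is
    a multiple of [x 1], as in [phi4]. *)
Lemma entry_row2 r : (0 < r)%N -> (r + 5 <= n)%N ->
  d 1 (1 + r) = 0 -> d 2 (2 + r) = 0.
Proof.
move=> r0 rn d1; rewrite entry_scaled (_ : u r 2 = 0) ?mulr0 //.
have coef_neq0 : (r + 2 * 2 + 3)%:R != 0 :> K by rewrite pnatr_eq0; lia.
apply: (mulfI coef_neq0); rewrite (@scaled_sym 2 1 r) ?d1 ?mulr0 //; lia.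
Qed.

(** Degrees below [n - 5] carry only the multiples of [varphi]; from degree
    [n - 5] on, the prescribed zeros together with [entry_row2] cover the first
    three entries of each diagonal. *)
Lemma derivation_eq0 :
  d 1 1 = 0 -> (forall t, (t <= 4)%N -> d 1 (n - t) = 0) ->
  (forall t, (t <= 2)%N -> d 2 (n - t) = 0) ->
  (forall t, (t <= 2)%N -> d 3 (n - t) = 0) -> D = 0.
Proof.
move=> d11 d1 d2 d3; apply: entry_eq0 => k t _ _.
case: (ltnP t k) => [|kt]; first exact: entry_lower.
have [r ->] : exists r, t = (k + r)%N by exists (t - k)%N; lia.
case: (leqP (r + 6) n) => rn.
  case: r rn => [|[|r]] rn; last exact: entry_diag_mid.
    by rewrite addn0 entry_diag0.
  exact: entry_diag1.
have top c j : (forall t, (t <= c)%N -> d j (n - t) = 0) ->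
    (n <= j + r + c)%N -> d j (j + r) = 0.
  move=> dj jc; case: (leqP (j + r) n) => jr; last first.
    by rewrite entry_col_out //; lia.
  by rewrite (_ : j + r = n - (n - (j + r)))%N ?dj //; lia.
apply: entry_diag_eq0; first by apply: (top 4%N) => //; lia.
  case: (leqP n (r + 4)) => r4; first by apply: (top 2%N) => //; lia.
  apply: entry_row2; try lia; apply: (top 4%N) => //; lia.
by apply: (top 2%N) => //; lia.
Qed.

End Derivation.
End Rigidity.

(** * The generators are derivations and span them all *)

Section Generators.
Variables (K : numFieldType) (n : nat).
Hypothesis n8 : (8 <= n)%N.
Local Notation V := 'rV[K]_n.
Local Notation e := (@e K n).
Local Notation mul := (@idd_mul K n).

Local Notation N := (n%:R : K).

Lemma entry_der_cleared (D : 'End(V)) i j t q p :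
  (t - j - 2 = q)%N -> (t - i - 2 = p)%N ->
  (p.+1 * p.+2)%N%:R * (entry D (i + j + 2) t - entry D i q)
  = (j.+1 * j.+2)%N%:R * entry D j p -> entry_der D i j t.
Proof.
rewrite /entry_der /struct_const => -> -> eqD.
have p0 : (p.+1 * p.+2)%N%:R != 0 :> K by rewrite pnatr_eq0.
have j0 : (j.+1 * j.+2)%N%:R != 0 :> K by rewrite pnatr_eq0.
rewrite (_ : entry D (i + j + 2) t = entry D i q + (p.+1 * p.+2)%N%:R^-1 *
  ((j.+1 * j.+2)%N%:R * entry D j p)).
  by rewrite mulrDr [X in _ + X]mulrCA mulKf.
by rewrite -eqD mulKf // addrC subrK.
Qed.

(** A map that raises the index by at least [n - 5] can violate the Leibniz rule
    only when [i + j <= 3], since otherwise all three terms fall beyond [e n];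
    four scalar equations remain. *)
Lemma high_degree_derivation (D : 'End(V)) :
  (forall k t, (0 < k <= n)%N -> (0 < t <= n)%N -> (t + 5 < k + n)%N ->
     entry D k t = 0) ->
  (N - 3) * (N - 2) * (entry D 4 (n - 1) - entry D 1 (n - 4))
    = 6 * entry D 1 (n - 4) ->
  (N - 2) * (N - 1) * (entry D 4 n - entry D 1 (n - 3))
    = 6 * entry D 1 (n - 3) ->
  (N - 2) * (N - 1) * (entry D 5 n - entry D 1 (n - 4))
    = 12 * entry D 2 (n - 3) ->
  (N - 3) * (N - 2) * (entry D 5 n - entry D 2 (n - 3))
    = 6 * entry D 1 (n - 4) ->
  is_derivation mul D.
Proof.
move=> degD eq11' eq11 eq12 eq21; apply/derivationP => i j t iin jin tn.
have low k t' : (0 < k)%N -> (t' + 5 < k + n)%N -> entry D k t' = 0.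
  move=> k0 t'k; case: (leqP k n) => kn; last by rewrite entry_row_out.
  case: (boolP (0 < t' <= n)%N) => t'n; last by rewrite entry_col_out.
  by apply: degD => //; lia.
case: (ltnP (t + 3) (i + j + n)) => tij.
  by rewrite /entry_der !low ?mulr0 ?addr0 //; lia.
have natrN k : (k <= n)%N -> N - k%:R = (n - k)%:R by move=> ?; rewrite natrB.
have n3 : ((n - 4).+1 * (n - 4).+2)%N%:R = (N - 3) * (N - 2).
  by rewrite (natrN 3) ?(natrN 2) -?natrM; try lia; congr (_%:R); lia.
have n2 : ((n - 3).+1 * (n - 3).+2)%N%:R = (N - 2) * (N - 1).
  by rewrite (natrN 2) ?(natrN 1%N) -?natrM; try lia; congr (_%:R); lia.
case: i j iin jin tij => [|[|[|i]]] [|[|[|j]]] iin jin tij; try lia.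
- have [->|tn'] := eqVneq t n.
    by apply: (@entry_der_cleared _ _ _ _ (n - 3) (n - 3)); rewrite ?n2 //; lia.
  rewrite (_ : t = n - 1)%N; last lia.
  by apply: (@entry_der_cleared _ _ _ _ (n - 4) (n - 4)); rewrite ?n3 //; lia.
- rewrite (_ : t = n); last lia.
  by apply: (@entry_der_cleared _ _ _ _ (n - 4) (n - 3)); rewrite ?n2 //; lia.
rewrite (_ : t = n); last lia.
by apply: (@entry_der_cleared _ _ _ _ (n - 3) (n - 4)); rewrite ?n3 //; lia.
Qed.

Lemma entry_linext (f : nat -> V) k t : (0 < k <= n)%N ->
  entry (linext f) k t = ecoef t (f k).
Proof. by move=> kn; rewrite /entry linext_e. Qed.

Lemma ecoefZe a p t : (0 < t <= n)%N -> ecoef t (a *: e p) = a * (p == t)%:R.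
Proof. by move=> tn; rewrite ecoefZ ecoef_e tn andbT. Qed.

Lemma entry_varphi k t : (0 < k <= n)%N -> (0 < t <= n)%N ->
  entry (@varphi K n) k t = (k + 2)%:R * (k == t)%:R.
Proof. by move=> kn tn; rewrite entry_linext // ecoefZe. Qed.

Lemma entry_unit_map s u k t : (0 < k <= n)%N -> (0 < t <= n)%N ->
  entry (@unit_map K n s u) k t = ((k == s) && (n - u == t)%N)%:R.
Proof.
move=> kn tn; rewrite entry_linext //; case: eqP => _; last by rewrite linear0.
by rewrite ecoef_e tn andbT.
Qed.

Lemma entry_phi4 k t : (0 < k <= n)%N -> (0 < t <= n)%N ->
  entry (@phi4 K n) k t =
  match k with
  | 1 => ((N - 3) * (N ^+ 2 - 4)) * (n - 4 == t)%N%:R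
  | 2 => (N * (N - 1) * (N - 2)) * (n - 3 == t)%N%:R
  | 4 => ((N + 2) * (N ^+ 2 - 5 * N + 12)) * (n - 1 == t)%N%:R
  | 5 => ((N + 1) * (N ^+ 2 - 4 * N + 12)) * (n == t)%N%:R
  | _ => 0
  end.
Proof.
move=> kn tn; rewrite entry_linext //.
by case: k kn => [|[|[|[|[|[|k]]]]]] kn; rewrite ?linear0 ?ecoefZe.
Qed.

Lemma entry_phi3 k t : (0 < k <= n)%N -> (0 < t <= n)%N ->
  entry (@phi3 K n) k t =
  match k with
  | 1 => ((N - 1) * (N - 2)) * (n - 3 == t)%N%:R
  | 4 => (N ^+ 2 - 3 * N + 8) * (n == t)%N%:R
  | _ => 0
  end.
Proof.
move=> kn tn; rewrite entry_linext //.
by case: k kn => [|[|[|[|[|k]]]]] kn; rewrite ?linear0 ?ecoefZe.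
Qed.

Lemma varphi_derivation : is_derivation mul (@varphi K n).
Proof.
apply/derivationP => i j t iin jin tn; rewrite /entry_der.
have [tij|tij] := eqVneq t (i + j + 2)%N.
  rewrite {t}tij in tn *; rewrite !entry_varphi; try lia.
  rewrite (_ : i + j + 2 - j - 2 = i)%N; last lia.
  rewrite (_ : i + j + 2 - i - 2 = j)%N; last lia.
  by rewrite !eqxx; ring.
have off k t' : (0 < k <= n)%N -> (t' <= n)%N -> k != t' ->
    entry (@varphi K n) k t' = 0.
  move=> kn t'n /negPf kt'; case: (posnP t') => [->|t'0].
    by rewrite entry_col_out.
  by rewrite entry_varphi ?kt' ?mulr0 //; lia.
rewrite (off i) ?(off j) ?mulr0 ?addr0; try lia.
case: (leqP (i + j + 2) n) => ijn; last by rewrite entry_row_out ?mulr0.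
by rewrite off ?mulr0 //; lia.
Qed.

Lemma unit_map_derivation s u : (s <= 3)%N -> (u <= 2)%N ->
  is_derivation mul (@unit_map K n s u).
Proof.
move=> s3 u2.
have zero k t : (0 < k <= n)%N -> (0 < t <= n)%N ->
    (3 < k)%N || (t + 2 < n)%N -> entry (@unit_map K n s u) k t = 0.
  move=> kn tn kt; rewrite entry_unit_map //.
  by case: (k =P s) => // ?; case: ((n - u)%N =P t) => // ?; lia.
apply: high_degree_derivation => [k t kn tn tk||||].
- by apply: zero => //; lia.
all: by rewrite !zero ?subr0 ?mulr0 //; lia.
Qed.

Lemma phi3_derivation : is_derivation mul (@phi3 K n).
Proof.
have zero k t : (0 < k <= n)%N -> (0 < t <= n)%N -> (t != k + n - 4)%N ->
    entry (@phi3 K n) k t = 0.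
  move=> kn tn kt; rewrite entry_phi3 //.
  case: k kn kt => [|[|[|[|[|k]]]]] kn kt //;
    by rewrite (_ : (_ == t) = false) ?mulr0 //; lia.
have d1 : entry (@phi3 K n) 1 (n - 3) = (N - 1) * (N - 2).
  by rewrite entry_phi3 ?eqxx ?mulr1 //; lia.
have d4 : entry (@phi3 K n) 4 n = N ^+ 2 - 3 * N + 8.
  by rewrite entry_phi3 ?eqxx ?mulr1 //; lia.
apply: high_degree_derivation => [k t kn tn tk||||].
- by apply: zero; rewrite //; lia.
- by rewrite !zero ?subr0 ?mulr0 //; lia.
- by rewrite d1 d4; ring.
- by rewrite !zero ?subr0 ?mulr0 //; lia.
by rewrite !zero ?subr0 ?mulr0 //; lia.
Qed.

Lemma phi4_derivation : is_derivation mul (@phi4 K n).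
Proof.
have d1 : entry (@phi4 K n) 1 (n - 4) = (N - 3) * (N ^+ 2 - 4).
  by rewrite entry_phi4 ?eqxx ?mulr1 //; lia.
have d2 : entry (@phi4 K n) 2 (n - 3) = N * (N - 1) * (N - 2).
  by rewrite entry_phi4 ?eqxx ?mulr1 //; lia.
have d4 : entry (@phi4 K n) 4 (n - 1) = (N + 2) * (N ^+ 2 - 5 * N + 12).
  by rewrite entry_phi4 ?eqxx ?mulr1 //; lia.
have d5 : entry (@phi4 K n) 5 n = (N + 1) * (N ^+ 2 - 4 * N + 12).
  by rewrite entry_phi4 ?eqxx ?mulr1 //; lia.
have zero k t : (0 < k <= n)%N -> (0 < t <= n)%N -> (t != k + n - 5)%N ->
    entry (@phi4 K n) k t = 0.
  move=> kn tn kt; rewrite entry_phi4 //.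
  case: k kn kt => [|[|[|[|[|[|k]]]]]] kn kt //;
    by rewrite (_ : (_ == t) = false) ?mulr0 //; lia.
apply: high_degree_derivation => [k t kn tn tk||||].
- by apply: zero => //; lia.
- by rewrite d1 d4; ring.
- by rewrite !zero ?subr0 ?mulr0 //; lia.
- by rewrite d1 d2 d5; ring.
by rewrite d1 d2 d5; ring.
Qed.

Local Notation gens := (@der_generators K n).

Lemma der_generators_derivation : {in gens, forall D, is_derivation mul D}.
Proof.
move=> D; rewrite inE => /predU1P[->|]; first exact: varphi_derivation.
rewrite !mem_cat => /or3P[]/mapP[t]; rewrite mem_iota => /andP[_ t_lt] ->.
- case: t t_lt => [|[|[|[|[|]]]]] // _;
    by [apply: unit_map_derivation | apply: phi3_derivation
       | apply: phi4_derivation].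
- exact: unit_map_derivation.
exact: unit_map_derivation.
Qed.

Lemma phi_span t : (t < 5)%N -> phi K n t \in <<gens>>%VS.
Proof.
move=> t5; apply: memv_span; rewrite inE !mem_cat map_f ?orbT //.
by rewrite mem_iota.
Qed.

Lemma psi_span t : (t < 3)%N -> psi K n t \in <<gens>>%VS.
Proof.
move=> t3; apply: memv_span; rewrite inE !mem_cat (map_f (@psi K n)) ?orbT //.
by rewrite mem_iota.
Qed.

Lemma pi_span t : (t < 3)%N -> pi_ K n t \in <<gens>>%VS.
Proof.
move=> t3; apply: memv_span; rewrite inE !mem_cat (map_f (@pi_ K n)) ?orbT //.
by rewrite mem_iota.
Qed.

(** The correction [D'] is built so that the twelve entries of [derivation_eq0]
    cancel; [a4] and [a3] are the first-row entries of [phi4] and [phi3]. *)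
Lemma derivation_in_span D : is_derivation mul D -> D \in <<gens>>%VS.
Proof.
move=> derD.
pose a4 : K := (N - 3) * (N ^+ 2 - 4); pose a3 : K := (N - 1) * (N - 2).
pose D' : 'End(V) :=
  - (entry D 1 1 / 3) *: varphi K n
  + (- (entry D 1 (n - 4) / a4) *: phi4 K n
  + (- (entry D 1 (n - 3) / a3) *: phi3 K n
  + (- entry D 1 (n - 2) *: unit_map K n 1 2
  + (- entry D 1 (n - 1) *: unit_map K n 1 1
  + (- entry D 1 (n - 0) *: unit_map K n 1 0
  + (- entry D 2 (n - 2) *: unit_map K n 2 2
  + (- entry D 2 (n - 1) *: unit_map K n 2 1
  + (- entry D 2 (n - 0) *: unit_map K n 2 0
  + (- entry D 3 (n - 2) *: unit_map K n 3 2
  + (- entry D 3 (n - 1) *: unit_map K n 3 1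
  + (- entry D 3 (n - 0) *: unit_map K n 3 0
  + D))))))))))).
suff : D' \in <<gens>>%VS.
  have varphi_span : varphi K n \in <<gens>>%VS by apply/memv_span/mem_head.
  have [phi4_span phi3_span] := (phi_span (t := 4) isT, phi_span (t := 3) isT).
  have unit_span s t : (0 < s < 4)%N -> (t < 3)%N ->
      unit_map K n s t \in <<gens>>%VS.
    case: s => [|[|[|[|]]]] // _; [|exact: psi_span|exact: pi_span].
    move=> t3; have := phi_span (ltn_trans t3 (isT : 3 < 5)%N).
    by case: t t3 => [|[|[|]]].
  rewrite /D'.
  by do 12?[rewrite rpredDl; last by apply: rpredZ => //; apply: unit_span].
suff -> : D' = 0 by apply: mem0v.
have n_sub_neq0 k : (k < n)%N -> N - k%:R != 0.
  by move=> kn; rewrite -natrB 1?ltnW // pnatr_eq0; lia.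
have a3_neq0 : a3 != 0.
  by rewrite mulf_neq0 ?(n_sub_neq0 1%N) ?n_sub_neq0 //; lia.
have a4_neq0 : a4 != 0.
  rewrite (_ : a4 = (N - 3) * ((N - 2) * (n + 2)%:R)); last first.
    by rewrite /a4; ring.
  by rewrite !mulf_neq0 ?n_sub_neq0 ?pnatr_eq0 //; lia.
have derD' : is_derivation mul D'.
  rewrite /D';
    do ![apply: derivation_comb => //; try exact: unit_map_derivation];
    by [apply: varphi_derivation | apply: phi4_derivation
       | apply: phi3_derivation].
have sub_eq a b : (a < 5)%N -> (b < 5)%N ->
    (n - a == n - b)%N = (a == b) by lia.
have hi_lo a k : (a < 5)%N -> (k < 4)%N -> (n - a == k)%N = false by lia.
have lo_hi a k : (a < 5)%N -> (k < 4)%N -> (k == n - a)%N = false by lia.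
apply: (derivation_eq0 n8 derD') => [|t t4|t t2|t t2].
- rewrite !entry_comb entry_varphi ?entry_phi4 ?entry_phi3 ?entry_unit_map;
    try lia.
  rewrite !hi_lo //= !mulr0 !add0r mulr1 mulNr divfK ?pnatr_eq0 //.
  by rewrite addNr.
- case: t t4 => [|[|[|[|[|]]]]] // _;
    rewrite !entry_comb entry_varphi ?entry_phi4 ?entry_phi3 ?entry_unit_map;
      try lia;
    by rewrite !sub_eq // !lo_hi //= -/a3 -/a4 ?(mulr0, mulr1, add0r) ?mulNr
      ?(divfK a3_neq0) ?(divfK a4_neq0) ?addNr.
- case: t t2 => [|[|[|]]] // _;
    rewrite !entry_comb entry_varphi ?entry_phi4 ?entry_phi3 ?entry_unit_map;
      try lia;
    by rewrite !sub_eq // !lo_hi //= ?(mulr0, mulr1, add0r, addNr).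
case: t t2 => [|[|[|]]] // _;
  rewrite !entry_comb entry_varphi ?entry_phi4 ?entry_phi3 ?entry_unit_map;
    try lia;
  by rewrite !sub_eq // !lo_hi //= ?(mulr0, mulr1, add0r, addNr).
Qed.

End Generators.

Theorem theorem4p35 (R : realType) (n : nat) (hn : (8 <= n)%N)
    (D : 'End('rV[R[i]]_n)) :
  is_derivation (@idd_mul R[i] n) D <-> D \in <<der_generators R[i] n>>%VS.
Proof.
split; first exact: derivation_in_span.
exact: (derivation_span (der_generators_derivation hn)).
Qed.
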